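(* Let $G$ be a graph. Then ${\sf sd}(G)=0$ if and only if $E(G)=\emptyset$.
   Context: Graphs are finite, simple and undirected, with nonempty vertex set $V=V(G)=\{1,\dots,n\}$ and edge set $E=E(G)$. ${\cal S}^n_+$ is the set of real symmetric positive semidefinite $n\times n$ matrices. For $c\in[-1,1]^{E}$, the problem ${\rm P}(G,c)$ has feasible set $\{X\in{\cal S}^n_+ : X[i,i]=1\ (i\in V),\ X[i,j]=c(ij)\ (ij\in E)\}$; ${\cal E}(G)$ is the set of $c\in[-1,1]^E$ for which this set is nonempty. A stress is a vector $\omega\in\mathbb{R}^{V\cup E}$; its matrix is $\Omega=\sum_{i\in V}\omega(i)E_{ii}+\sum_{ij\in E}\omega(ij)E_{ij}$, where $E_{ij}=({\bf e}_i{\bf e}_j^{\top}+{\bf e}_j{\bf e}_i^{\top})/2$ (a superscript on $\omega$ is inherited by $\Omega$). For a sequence $\omega^1,\dots,\omega^k$ put ${\cal V}^0=\mathbb{R}^n$ and ${\cal V}^j=\{x\in\mathbb{R}^n : x^{\top}\Omega^i x=0\ (i=1,\dots,j)\}$. Singularity degree: for $c\in{\cal E}(G)$, ${\sf sd}(G,c)=0$ if ${\rm P}(G,c)$ has a positive definite feasible solution; otherwise ${\sf sd}(G,c)$ is the smallest $k$ for which there are stresses $\omega^1,\dots,\omega^k$ such that: (1) for each $j$, $x^{\top}\Omega^j x\ge 0$ for all $x\in{\cal V}^{j-1}$; (2) for each $j$, $\sum_{i\in V}\omega^j(i)+\sum_{ij\in E}\omega^j(ij)c(ij)\le 0$; (3)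 $\dim{\cal V}^k=s$, where $s$ is the maximum rank of a feasible solution of ${\rm P}(G,c)$. Finally ${\sf sd}(G)=\max\{{\sf sd}(G,c) : c\in{\cal E}(G)\}$. *)

(* Defs.v *)
From HB Require Import structures.
From mathcomp Require Import all_boot all_order all_algebra.
From mathcomp Require Import reals.

Set Implicit Arguments.
Unset Strict Implicit.
Unset Printing Implicit Defensive.

Import Order.TTheory GRing.Theory Num.Theory.
Local Open Scope ring_scope.

Record sgraph (n : nat) := SGraph {
  adj : rel 'I_n;
  adj_sym : symmetric adj;
  adj_irr : irreflexive adj }.

(* The unordered edge {i, j} is represented by the pair (i, j) with i < j, so
   that sums over edges count every edge exactly once. *)
Definition edge_set n (G : sgraph n) : {set 'I_n * 'I_n} :=
  [set p : 'I_n * 'I_n | (p.1 < p.2)%N && adj G p.1 p.2].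

Definition edge n (G : sgraph n) := {p : 'I_n * 'I_n | p \in edge_set G}.

Section Completion.
Variables (R : realType) (n : nat).

Definition qform (A : 'M[R]_n) (x : 'cV[R]_n) : R := (x^T *m A *m x) 0 0.

Definition psd (A : 'M[R]_n) : Prop :=
  A^T = A /\ forall x : 'cV[R]_n, 0 <= qform A x.

Definition posdef (A : 'M[R]_n) : Prop :=
  A^T = A /\ forall x : 'cV[R]_n, x != 0 -> 0 < qform A x.

Variable G : sgraph n.

Definition in_box (c : {ffun edge G -> R}) : Prop :=
  forall e : edge G, -1 <= c e <= 1.

Definition feasible (c : {ffun edge G -> R}) (X : 'M[R]_n) : Prop :=
  [/\ psd X,
      forall i : 'I_n, X i i = 1 &
      forall e : edge G, X (val e).1 (val e).2 = c e].

(* The set of c in [-1,1]^E for which P(G,c) is feasible. *)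
Definition elliptope (c : {ffun edge G -> R}) : Prop :=
  in_box c /\ exists X : 'M[R]_n, feasible c X.

Definition has_posdef_solution (c : {ffun edge G -> R}) : Prop :=
  exists X : 'M[R]_n, feasible c X /\ posdef X.

Definition is_max_rank (c : {ffun edge G -> R}) (s : nat) : Prop :=
  (exists X : 'M[R]_n, feasible c X /\ \rank X = s) /\
  (forall X : 'M[R]_n, feasible c X -> (\rank X <= s)%N).

Definition stress := {ffun 'I_n + edge G -> R}.

Definition sym_unit (i j : 'I_n) : 'M[R]_n :=
  2^-1 *: (delta_mx i j + delta_mx j i).

Definition stress_mx (w : stress) : 'M[R]_n :=
  \sum_(i < n) w (inl i) *: sym_unit i i +
  \sum_(e : edge G) w (inr e) *: sym_unit (val e).1 (val e).2.

(* [common_null w j] is V^j. The stresses w^1, ..., w^k are indexed from 0, so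
   V^j is cut out by the stresses of index i < j. *)
Definition common_null k (w : 'I_k -> stress) (j : nat) (x : 'cV[R]_n) : Prop :=
  forall i : 'I_k, (i < j)%N -> qform (stress_mx (w i)) x = 0.

(* Only linear subspaces have a dimension. *)
Definition has_dim (S : 'cV[R]_n -> Prop) (d : nat) : Prop :=
  exists U : {vspace 'cV[R]_n}, (forall x, x \in U <-> S x) /\ \dim U = d.

Definition sd_sequence (c : {ffun edge G -> R}) k (w : 'I_k -> stress) : Prop :=
  [/\ forall (j : 'I_k) (x : 'cV[R]_n),
        common_null w j x -> 0 <= qform (stress_mx (w j)) x,
      forall j : 'I_k,
        \sum_(i < n) w j (inl i) + \sum_(e : edge G) w j (inr e) * c e <= 0 &
      exists s : nat, is_max_rank c s /\ has_dim (common_null w k) s].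

(* [is_sd_at c k] is "sd(G,c) = k", for c in the elliptope. *)
Definition is_sd_at (c : {ffun edge G -> R}) (k : nat) : Prop :=
  (has_posdef_solution c /\ k = 0%N) \/
  [/\ ~ has_posdef_solution c,
      exists w : 'I_k -> stress, sd_sequence c w &
      forall (l : nat) (w : 'I_l -> stress), sd_sequence c w -> (k <= l)%N].

(* [is_sd d] is "sd(G) = d". The existential in the second clause makes
   sd(G,c) being defined for every c in the elliptope part of the assertion,
   rather than letting undefined values pass vacuously. *)
Definition is_sd (d : nat) : Prop :=
  (exists c : {ffun edge G -> R}, elliptope c /\ is_sd_at c d) /\
  (forall c : {ffun edge G -> R}, elliptope c ->
     exists k : nat, is_sd_at c k /\ (k <= d)%N).

Lemma is_sd_at_unique (c : {ffun edge G -> R}) (k l : nat) :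
  is_sd_at c k -> is_sd_at c l -> k = l.
Proof.
case=> [[pk ->]|[npk [w wk] mk]] [[pl ->]|[npl [v vl] ml]] //.
by apply/eqP; rewrite eqn_leq (mk _ _ vl) (ml _ _ wk).
Qed.

Lemma is_sd_unique (d d' : nat) : is_sd d -> is_sd d' -> d = d'.
Proof.
move=> [[c [cE cd]] dmax] [[c' [cE' cd']] dmax'].
have [k [ck kd']] := dmax' c cE; have [k' [ck' kd]] := dmax c' cE'.
rewrite (is_sd_at_unique ck cd) in kd'; rewrite (is_sd_at_unique ck' cd') in kd.
by apply/eqP; rewrite eqn_leq kd' kd.
Qed.

End Completion.

(* Main.v *)
Require Import Defs.
From HB Require Import structures.
From mathcomp Require Import all_boot all_order all_algebra.
From mathcomp Require Import reals.
From mathcomp Require Import ring lra.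

Set Implicit Arguments.
Unset Strict Implicit.
Unset Printing Implicit Defensive.

Import Order.TTheory GRing.Theory Num.Theory.
Local Open Scope ring_scope.

(** The singularity degree at [c] vanishes exactly when the completion problem
    has a positive definite solution. Indeed the empty sequence of stresses cuts
    out the whole space, so its condition on the dimension says that some
    feasible matrix has full rank, and a nonsingular positive semidefinite
    matrix is positive definite ([psd_unit_posdef]). Hence [sd(G) = 0] means
    that every [c] in the elliptope has a positive definite completion.

    Without edges the identity matrix is such a completion. With an edge [ij],
    take [c] to be constantly 1: the all-ones matrix is feasible, but every
    feasible [X] satisfies [q_X(e_i - e_j) = 1 - 2 + 1 = 0]
    ([qform_delta_sub]), so none is positive definite. *)

Lemma dotmx_ge0 (R : realType) (n : nat) (x : 'cV[R]_n) : 0 <= (x^T *m x) 0 0.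
Proof.
by rewrite mxE; apply: sumr_ge0 => i _; rewrite mxE -expr2 sqr_ge0.
Qed.

Lemma dotmx_eq0 (R : realType) (n : nat) (x : 'cV[R]_n) :
  (x^T *m x) 0 0 = 0 -> x = 0.
Proof.
rewrite mxE => /eqP; rewrite psumr_eq0 => [/allP x0|i _]; last first.
  by rewrite mxE -expr2 sqr_ge0.
apply/colP => i; have /implyP/(_ isT) := x0 i (mem_index_enum i).
by rewrite !mxE mulf_eq0 orbb => /eqP.
Qed.

Lemma qformD (R : realType) (n : nat) (A : 'M[R]_n) (x y : 'cV[R]_n) (t : R) :
  A^T = A ->
  qform A (x + t *: y) =
    qform A x + 2 * t * (y^T *m (A *m x)) 0 0 + t ^+ 2 * qform A y.
Proof.
move=> symA; have xAy : x^T *m A *m y = y^T *m A *m x.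
  have tr1 (M : 'M[R]_1) : M^T = M.
    by apply/matrixP => i j; rewrite mxE !ord1.
  by rewrite -[LHS]tr1 !trmx_mul trmxK symA mulmxA.
rewrite /qform mulmxA !linearD !linearZ /= !mulmxDl -!scalemxAl xAy.
rewrite !mxE; ring.
Qed.

(** An isotropic vector [x] minimises the form. Moving from [x] in the direction
    [- A x] changes the form by [- 2 |A x|^2] to first order, so a nonzero [A x]
    would make it negative. *)
Lemma psd_isotropic_ker (R : realType) (n : nat) (A : 'M[R]_n) (x : 'cV[R]_n) :
  psd A -> qform A x = 0 -> A *m x = 0.
Proof.
move=> [symA A_ge0] qx0; apply: dotmx_eq0.
set y := A *m x; set a := (y^T *m y) 0 0; set b := qform A y.
have a_ge0 : 0 <= a := dotmx_ge0 y.
have b_ge0 : 0 <= b := A_ge0 y.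
(* The step [a / (b + 1)] is short enough for the first-order term to dominate,
   also when [b = 0]. *)
set s := a / (b + 1).
have aE : a = s * (b + 1) by rewrite /s divfK //; apply: lt0r_neq0; lra.
have s_ge0 : 0 <= s by rewrite /s divr_ge0 //; lra.
have := A_ge0 (x + (- s) *: y); rewrite qformD // qx0 -/y -/a -/b aE => q_ge0.
have : s ^+ 2 <= 0 by nra.
rewrite exprn_even_le0 //= => /eqP ->; exact: mul0r.
Qed.

Lemma psd_unit_posdef (R : realType) (n : nat) (A : 'M[R]_n) :
  psd A -> A \in unitmx -> posdef A.
Proof.
move=> psdA unitA; have [symA A_ge0] := psdA; split=> // x x_neq0.
rewrite lt_neqAle A_ge0 andbT eq_sym; apply: contra x_neq0 => /eqP qx0.
by rewrite -(mulKmx unitA x) (psd_isotropic_ker psdA qx0) mulmx0.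
Qed.

Lemma posdef1 (R : realType) (n : nat) : posdef (1%:M : 'M[R]_n).
Proof.
split=> [|x x_neq0]; first exact: trmx1.
rewrite /qform mulmx1 lt_neqAle dotmx_ge0 andbT eq_sym.
by apply: contra x_neq0 => /eqP/dotmx_eq0 ->.
Qed.

Lemma posdef_psd (R : realType) (n : nat) (A : 'M[R]_n) : posdef A -> psd A.
Proof.
move=> [symA A_gt0]; split=> // x; have [->|/A_gt0/ltW //] := eqVneq x 0.
by rewrite /qform mulmx0 mxE.
Qed.

Lemma psd_const1 (R : realType) (n : nat) : psd (const_mx 1 : 'M[R]_n).
Proof.
split=> [|x]; first exact: trmx_const.
(* The all-ones matrix is the Gram matrix of n copies of the scalar 1. *)
have -> : const_mx 1 = (const_mx 1 : 'rV[R]_n)^T *m (const_mx 1 : 'rV[R]_n).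
  by apply/matrixP => i j; rewrite !mxE big_ord1 !mxE mulr1.
rewrite /qform mulmxA -mulmxA -trmx_mul; exact: dotmx_ge0.
Qed.

Lemma qform_delta_sub (R : realType) (n : nat) (A : 'M[R]_n) (i j : 'I_n) :
  A^T = A ->
  qform A (delta_mx i 0 - delta_mx j 0) = A i i - 2 * A i j + A j j.
Proof.
pose e k : 'cV[R]_n := delta_mx k 0.
have entry k l : ((e k)^T *m (A *m e l)) 0 0 = A k l.
  by rewrite trmx_delta -rowE -colE !mxE.
have qdelta k : qform A (e k) = A k k by rewrite /qform -mulmxA entry.
move=> symA; have Aji : A j i = A i j by rewrite -{1}symA mxE.
rewrite -/(e i) -/(e j) -scaleN1r qformD // !qdelta entry Aji; ring.
Qed.

(** For [k = 0] the common null space is everything, whence the maximum rank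
    is [n]. *)
Lemma is_sd_at0_posdef (R : realType) (n : nat) (G : sgraph n)
    (c : {ffun edge G -> R}) :
  is_sd_at c 0 -> has_posdef_solution c.
Proof.
move=> [[] //|[_ [w [_ _ [s [[[X [feasX rankX]] _] [U [memU dimU]]]]]] _]].
have U_full : U = fullv.
  by apply/vspaceP => x; rewrite memvf; apply/memU => -[].
exists X; split=> //; have [psdX _ _] := feasX.
apply: psd_unit_posdef => //; rewrite -row_full_unit /row_full rankX -dimU.
by rewrite U_full dimvf /dim /= muln1.
Qed.

Theorem theorem4p4 (R : realType) (n : nat) (n_gt0 : (0 < n)%N)
  (G : sgraph n) :
  is_sd R G 0 <-> edge_set G = set0.
Proof.
split=> [[_ sd0]|E0].
  apply/eqP; apply/negP => /negP/set0Pn[p pE].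
  pose c : {ffun edge G -> R} := [ffun=> 1].
  have cE : elliptope c.
    split=> [e|]; first by rewrite ffunE; apply/andP; split; lra.
    exists (const_mx 1); split=> [|i|e]; [exact: psd_const1|by rewrite mxE|].
    by rewrite mxE ffunE.
  have [k [+ k_le0]] := sd0 c cE.
  move: k_le0; rewrite leqn0 => /eqP -> /is_sd_at0_posdef.
  move=> [X [[_ diagX edgeX] [symX X_gt0]]].
  have Xp : X p.1 p.2 = 1 by rewrite (edgeX (exist _ p pE)) ffunE.
  have ltp : (p.1 < p.2)%N by move: pE; rewrite inE => /andP[].
  have /X_gt0 : delta_mx p.1 0 - delta_mx p.2 0 != 0 :> 'cV[R]_n.
    apply/eqP => /colP/(_ p.1)/eqP.
    by rewrite !mxE !eqxx -val_eqE /= (ltn_eqF ltp) subr0 oner_eq0.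
  by rewrite qform_delta_sub // !diagX Xp; lra.
have no_edge (e : edge G) : False by case: e => p; rewrite E0 inE.
have feas1 (c : {ffun edge G -> R}) : feasible c 1%:M.
  split=> [|i|e]; [exact: posdef_psd (posdef1 _ _)|by rewrite mxE eqxx|].
  by case: (no_edge e).
have sd0 (c : {ffun edge G -> R}) : is_sd_at c 0.
  by left; split=> //; exists 1%:M; split; [exact: feas1|exact: posdef1].
split=> [|c _]; last by exists 0%N.
exists [ffun=> 0]; split=> //; split=> [e|]; first by case: (no_edge e).
by exists 1%:M; exact: feas1.
Qed.
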